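(* For every ordered continuum $\Lambda$ and every sequence $\vec{p}=\langle p_1,p_2,\dots\rangle$ of integers greater than $1$, the space $S(\Lambda,\vec{p})$ is an indecomposable circle-like continuum.
   Context: A continuum is a compact connected (Hausdorff) space, not necessarily metrizable. A continuum is indecomposable if it is not the union of two proper subcontinua. A continuum $S$ is circle-like if for each open cover $\mathcal{U}$ of $S$ there is a finite open cover $\{U_1,\dots,U_t\}$ refining $\mathcal{U}$ that forms a circular chain, i.e. $U_i\cap U_j\neq\emptyset$ if and only if $|i-j|\le 1 \pmod t$ (that is, $i-j\equiv 0$ or $\pm1 \pmod t$). An ordered continuum is a nondegenerate compact connected space $\Lambda$ which has a linear order and whose topology is the order topology; $\partial\Lambda$ is the set consisting of its first and last points. For $n\ge 1$, $\Lambda^{(n)}=\Lambda_1\vee\dots\vee\Lambda_n$ denotes $n$ copies of $\Lambda$ laid end to end (the last point of $\Lambda_i$ is identified with the first point of $\Lambda_{i+1}$, orders preserved), and $\Sigma^{(n)}=\Lambda^{(n)}/\partial\Lambda^{(n)}$ is the ''circle'' obtained by identifying the first and last points of $\Lambda^{(n)}$; $\Sigma=\Sigma^{(1)}$. The identified endpoints of the copies of $\Lambda$ in $\Sigma^{(n)}$ are labeled in cyclic order $\infty_0,\dots,\infty_{n-1}$, and for $x\in\Lambda\setminus\partial\Lambda$, $\infty_i+x$ denotes the copy of $x$ in the $i$th copy of $\Lambda$ (the one starting at $\infty_i$). For positive integers $m,n$ the $m$-fold covering map $\phi^m_n:\Sigma^{(mn)}\to\Sigma^{(n)}$ is given by $\phi^m_n(\infty_i)=\infty_j$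 and $\phi^m_n(\infty_i+x)=\infty_j+x$, where $j=i \bmod n$. For a sequence $\vec{p}=\langle p_1,p_2,\dots\rangle$ of positive integers, put $k(1)=1$ and $k(n)=p_1p_2\cdots p_{n-1}$ for $n>1$, and let $S(\Lambda,\vec{p})=\varprojlim\{\phi^{p_n}_{k(n)},\Sigma^{(k(n))},n\in\mathbb{N}\}$, the inverse limit with bonding maps $\phi^{p_n}_{k(n)}:\Sigma^{(k(n+1))}\to\Sigma^{(k(n))}$. *)

(* Defs.v *)
From HB Require Import structures.
From Stdlib Require Import Relation_Operators.
From mathcomp Require Import all_boot all_order.
From mathcomp Require Import all_classical.
From mathcomp Require Import topology.

Set Implicit Arguments.
Unset Strict Implicit.
Unset Printing Implicit Defensive.

Import Order.TTheory.
Local Open Scope classical_set_scope.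

Definition continuum (T : topologicalType) : Prop :=
  [/\ [set: T] !=set0, compact [set: T], connected [set: T]
    & hausdorff_space T].

(* Used in Hausdorff spaces only, so that separation is inherited by A. *)
Definition subcontinuum (T : topologicalType) (A : set T) : Prop :=
  [/\ A !=set0, compact A & connected A].

Definition indecomposable (T : topologicalType) : Prop :=
  ~ exists A B : set T,
      [/\ subcontinuum A /\ A <> [set: T], subcontinuum B /\ B <> [set: T]
        & A `|` B = [set: T]].

(* The links are numbered 0, ..., t - 1 instead of 1, ..., t.  No lower bound
   is put on t: for t <= 3 the condition says that all links meet. *)
Definition circular_chain (T : Type) (t : nat) (U : 'I_t -> set T) : Prop :=
  forall i j : 'I_t, U i `&` U j !=set0 <->
    [\/ i = j %[mod t], i = j.+1 %[mod t] | i.+1 = j %[mod t]].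

Definition circle_like (T : topologicalType) : Prop :=
  forall C : set (set T),
    (forall V, C V -> open V) -> \bigcup_(V in C) V = [set: T] ->
  exists t : nat, exists U : 'I_t -> set T,
    [/\ forall i, open (U i),
        \bigcup_i U i = [set: T],
        forall i, exists2 V, C V & U i `<=` V
      & circular_chain U].

(* The quotient of a space by the equivalence relation generated by R *)

Section Glue.
Local Open Scope quotient_scope.
Context {T : topologicalType} (R : T -> T -> Prop).

Definition glue_rel (x y : T) : bool := `[< clos_refl_sym_trans T R x y >].

Lemma glue_rel_refl : reflexive glue_rel.
Proof. by move=> x; apply/asboolP; apply: rst_refl. Qed.

Lemma glue_rel_sym : symmetric glue_rel.
Proof. by move=> x y; apply/idP/idP => /asboolP xy; apply/asboolP/rst_sym. Qed.

Lemma glue_rel_trans : transitive glue_rel.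
Proof.
by move=> y x z /asboolP xy /asboolP yz; apply/asboolP; apply: rst_trans xy yz.
Qed.

Definition glue_equiv := EquivRel _ glue_rel_refl glue_rel_sym glue_rel_trans.

Definition glue := {eq_quot glue_equiv}.
HB.instance Definition _ := Topological.copy glue (quotient_topology glue).
HB.instance Definition _ := Quotient.on glue.

Definition glue_pi (x : T) : glue := \pi_glue x.

Definition glue_repr (q : glue) : T := repr q.

Lemma glue_piP (x y : T) : R x y -> glue_pi x = glue_pi y.
Proof. by move=> Rxy; apply/eqmodP/asboolP/rst_step. Qed.

Lemma glue_repr_lift (Z : Type) (f : T -> Z) (x : T) :
  (forall y z, R y z -> f y = f z) -> f (glue_repr (glue_pi x)) = f x.
Proof.
move=> fR.
have fE y z : clos_refl_sym_trans T R y z -> f y = f z.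
  by elim=> [? ? /fR|?|? ? _ ->|? ? ? _ -> _ ->].
have /eqmodP/asboolP : \pi_glue (repr (glue_pi x)) = \pi_glue x by rewrite reprK.
exact: fE.
Qed.

End Glue.

Definition ordered_continuum (d : Order.disp_t) (L : orderTopologicalType d) :
    Prop :=
  [/\ exists x y : L, x <> y, compact [set: L] & connected [set: L]].

Section Circles.
Context {d : Order.disp_t} (L : orderTopologicalType d).

Definition is_first (x : L) : Prop := forall y : L, (x <= y)%O.
Definition is_last (x : L) : Prop := forall y : L, (y <= x)%O.

Definition copies (n : nat) : topologicalType := {i : 'I_n & L}.

Definition copy (n : nat) (i : 'I_n) (x : L) : copies n :=
  existT (fun _ : 'I_n => L) i x.

Definition consecutive_ends (n : nat) (a b : copies n) : Prop :=
  [/\ is_last (projT2 a), is_first (projT2 b)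
    & (projT1 a).+1 = projT1 b :> nat].

(* Lambda^(n): the disjoint sum of n copies of L, numbered from 0, with the last
   point of each copy glued to the first point of the next one.  Its quotient
   topology is that of the concatenated order. *)
Definition chain (n : nat) : topologicalType := glue (@consecutive_ends n).

Definition chain_pt (n : nat) (i : 'I_n) (x : L) : chain n :=
  glue_pi (@consecutive_ends n) (copy i x).

Definition chain_boundary (n : nat) : set (chain n) :=
  [set a | exists i : 'I_n, exists x : L, a = chain_pt i x /\
     ((i = 0%N :> nat /\ is_first x) \/ (i.+1 = n /\ is_last x))].

Definition both_ends (n : nat) (a b : chain n) : Prop :=
  chain_boundary a /\ chain_boundary b.

(* Sigma^(n) = Lambda^(n) / boundary *)
Definition circle (n : nat) : topologicalType := glue (@both_ends n).

(* [circle_pt i x] is the copy of x in the i-th arc: it is infty_i if x is the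
   first point of L, infty_(i + 1 mod n) if x is its last point, and
   infty_i + x otherwise. *)
Definition circle_pt (n : nat) (i : 'I_n) (x : L) : circle n :=
  glue_pi (@both_ends n) (chain_pt i x).

Lemma ord_mod_subproof (m n : nat) (i : 'I_(m * n)) : i %% n < n.
Proof. by rewrite ltn_pmod //; case: n i => // -[i]; rewrite muln0. Qed.

Lemma modnS_small_subproof (j n : nat) :
  (j %% n).+1 < n -> j.+1 %% n = (j %% n).+1.
Proof. by move=> ltn; rewrite -(modn_small ltn) -addn1 -modnDml addn1. Qed.

Definition ord_mod (m n : nat) (i : 'I_(m * n)) : 'I_n :=
  Ordinal (ord_mod_subproof i).

(* phi^m_n, computed on arbitrary representatives; [circle_coverE] shows that
   the choice of representatives is immaterial. *)
Definition circle_cover (m n : nat) (q : circle (m * n)) : circle n :=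
  let a := glue_repr (glue_repr q : chain (m * n)) in
  circle_pt (ord_mod (projT1 a)) (projT2 a).

Lemma circle_coverE (m n : nat) (i : 'I_(m * n)) (x : L) :
  circle_cover (circle_pt i x) = circle_pt (ord_mod i) x.
Proof.
pose f (a : copies (m * n)) := circle_pt (ord_mod (projT1 a)) (projT2 a).
have fE a b : consecutive_ends a b -> f a = f b.
  case: a b => [j y] [k z] [/= yl zf jk].
  have n_gt0 : 0 < n by apply: leq_ltn_trans (ltn_ord (ord_mod j)).
  case: (ltnP (j %% n).+1 n) => [lt_jn|le_nj].
    rewrite /f /circle_pt; congr (glue_pi _ _); apply: glue_piP; split => //=.
    by rewrite -jk modnS_small_subproof.
  have jn : (j %% n).+1 = n by apply/eqP; rewrite eqn_leq ltn_pmod.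
  apply: glue_piP; split; [exists (ord_mod j), y | exists (ord_mod k), z].
    by split => //; right.
  by split => //; left; rewrite /= -jk -addn1 -modnDml addn1 jn modnn.
rewrite /circle_cover -/(f _).
pose g (c : chain (m * n)) := f (glue_repr c).
have gE (j : 'I_(m * n)) y : g (chain_pt j y) = f (copy j y).
  exact: glue_repr_lift fE.
transitivity (g (chain_pt i x)); last exact: gE.
apply: (@glue_repr_lift _ _ _ g) => _ _ [[j [y [-> jy]]] [k [z [-> kz]]]].
rewrite !gE; apply: glue_piP.
suff bnd (l : 'I_(m * n)) w :
    (l = 0%N :> nat /\ is_first w) \/ (l.+1 = (m * n)%N /\ is_last w) ->
    chain_boundary (chain_pt (ord_mod l) w) by split; apply: bnd.
have n_gt0 : 0 < n by apply: leq_ltn_trans (ltn_ord (ord_mod l)).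
move=> lw; exists (ord_mod l), w; split => //.
case: lw => [[l0 wf]|[ln wl]]; [left|right]; split => //=.
  by rewrite l0 mod0n.
have := ltn_ord (ord_mod l); rewrite /= leq_eqVlt => /predU1P[//|lt_n].
by have := modnS_small_subproof lt_n; rewrite ln modnMl.
Qed.

End Circles.

Definition inverse_limit (X : nat -> topologicalType)
    (f : forall n, X n.+1 -> X n) : set (prod_topology X) :=
  [set x | forall n, f n (x n.+1) = x n].

(* Sequences are indexed from 0: here [p n] is p_(n+1) and [partial_prod p n] is
   k(n+1). *)
Fixpoint partial_prod (p : nat -> nat) (n : nat) : nat :=
  if n is n'.+1 then p n' * partial_prod p n' else 1.

Definition solenoid (d : Order.disp_t) (L : orderTopologicalType d)
    (p : nat -> nat) : topologicalType :=
  set_type (@inverse_limit (fun n => circle L (partial_prod p n))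
              (fun n => @circle_cover d L (p n) (partial_prod p n))).

(* Main.v *)
Require Import Defs.
From mathcomp Require Import all_boot all_order interval zify.
From mathcomp Require Import all_classical.
From mathcomp Require Import topology.

(** Write [Sigma_n] for the circle with [k n = partial_prod p n] arcs and
    [coord n] for the projection of the solenoid to it.

    Continuum.  [Sigma_n] is the image of the compact Hausdorff space of [k n]
    disjoint arcs under a closed map ([circle_map_closed]): gluing adds to a
    closed set at most the two ends of each arc.  It is therefore compact and
    Hausdorff, and the solenoid, closed in the product of the circles, is compact
    and Hausdorff too.  For connectedness, unroll the circles: [wind q x] is the
    point whose [n]-th coordinate is at position [x] of the arc numbered [q]
    modulo [k n].  The end of arc [q] is the start of arc [q + 1], so these points
    form a connected line; every arc of every circle is hit by it, and since the
    sets [coord n @^-1` U] are a basis ([nbhs_solenoid]), the line is dense.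

    Indecomposability.  Suppose two proper subcontinua [A] and [B] cover the
    solenoid.  At some level [n], [A] misses a whole fibre of [coord n], say over
    [u], and [B] misses the fibre over some [v].  As [p n > 1], the point [u] has
    two lifts to [Sigma_(n+1)] that are one turn of [Sigma_n] apart, and [B]
    contains points over both, because [A] does not.  But the lifts of [v] cut
    [Sigma_(n+1)] into arcs of one turn each, so they separate these two lifts of
    [u] ([circle_cover_separation]); [B] is connected and avoids every lift of
    [v], a contradiction.

    Circle-likeness.  By compactness an open cover is refined by the preimages of
    an open cover of a single [Sigma_n] ([open_cover_level]).  Compactness of the
    ordered continuum gives a subdivision so fine that, on every arc of [Sigma_n],
    the union of two successive edges lies in one member of that cover
    ([fine_subdivision]); the two edges around a glued endpoint are made small
    separately.  The edges of all arcs are numbered cyclically, and the links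
    are the sets of points that lie on no edge besides two successive ones. *)

Set Implicit Arguments.
Unset Strict Implicit.
Unset Printing Implicit Defensive.

Import Order.TTheory.
Local Open Scope classical_set_scope.

(** * Compactness, connectedness and separation *)

Section GeneralTopology.
Implicit Types T X Y : topologicalType.

(** The near-covering form of compactness, along the filter of finite sequences
    of indices ordered by inclusion. *)
Lemma compact_finite_subcover T (I : eqType) (U : I -> set T) :
  compact [set: T] -> (forall i, open (U i)) -> (forall x, exists i, U i x) ->
  exists s : seq I, forall x, exists2 i, i \in s & U i x.
Proof.
move=> /compact_near_coveringP ncT oU covU.
pose F : set_system (seq I) :=
  filter_from [set: seq I] (fun s0 => [set s | {subset s0 <= s}]).
have FF : Filter F.
  apply: filter_from_filter; first by exists [::].
  move=> s t _ _; exists (s ++ t) => // u stu.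
  by split=> x xs; apply: stu; rewrite mem_cat xs ?orbT.
have [s0 _ /(_ s0 (fun _ => id)) s0P] :
    \forall s \near F, [set: T] `<=` (fun x => exists2 i, i \in s & U i x).
  apply: ncT => x _; have [i Uix] := covU x.
  exists (U i, [set s | i \in s]) => /=; last first.
    by move=> [y s] /= [Uiy si]; exists i.
  split; first exact: open_nbhs_nbhs.
  by exists [:: i] => // s; apply; rewrite mem_head.
by exists s0 => x; exact: s0P.
Qed.

(** Inside [C] the sets [P] and [~` Q] coincide, so [C `&` P] is clopen in [C]. *)
Lemma connected_sub_closed T (C P Q : set T) : connected C -> closed P ->
  closed Q -> C `<=` P `|` Q -> C `&` (P `&` Q) = set0 -> C `&` P !=set0 ->
  C `<=` P.
Proof.
move=> cC cP cQ CPQ dCPQ CP0.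
suff <- : C `&` P = C by exact: subIsetr.
apply: cC => //; last by exists P.
exists (~` Q); first exact: closed_openC.
apply/seteqP; split=> x [Cx]; last by case: (CPQ x Cx).
by move=> Px; split=> // Qx; rewrite -[False]/(set0 x) -dCPQ.
Qed.

Lemma compact_set_type T (A : set T) : compact A -> compact [set: A].
Proof.
move=> cA F PF _.
have [|x [Ax clx]] := cA (set_val @ F) _.
  by apply: (@filterS _ F _ setT); [move=> x _; exact: set_valP|exact: filterT].
exists (SigSub (mem_set Ax)); split=> // B N FB [_ [[V oV <-] Vx VsubN]].
have [_ [[a Ba <-] Va]] : set_val @` B `&` V !=set0.
  apply: clx; last exact: open_nbhs_nbhs.
  by apply: (@filterS _ F _ B) FB => a Ba; exists a.
by exists a; split => //; exact: VsubN.
Qed.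

Lemma hausdorff_inj X Y (f : X -> Y) : continuous f -> injective f ->
  hausdorff_space Y -> hausdorff_space X.
Proof.
move=> cf inj_f hY x y clxy; apply/inj_f/hY => U V Ufx Vfy.
by have [z [Uz Vz]] := clxy _ _ (cf x _ Ufx) (cf y _ Vfy); exists (f z).
Qed.

Lemma closed_equalizer X Y (f g : X -> Y) : continuous f -> continuous g ->
  hausdorff_space Y -> closed [set x | f x = g x].
Proof.
move=> cf cg hY x clx; apply: hY => A B nA nB.
have [y [/= fgy [Ay By]]] :=
  clx _ (@filterI _ (nbhs x) _ (f @^-1` A) (g @^-1` B) (cf x _ nA) (cg x _ nB)).
by exists (f y); split=> //; rewrite fgy.
Qed.

(** Points of [X] are closed, being images of points, so distinct points have
    disjoint closed fibres.  Normality of [Y] puts the first fibre in an open set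
    whose closure misses the second; the images of the complement of this open set
    and of its closure are closed sets covering [X], and each misses one of the two
    points. *)
Lemma closed_map_hausdorff Y X (f : Y -> X) : compact [set: Y] ->
  hausdorff_space Y -> continuous f -> (forall x, exists y, f y = x) ->
  (forall K, closed K -> closed (f @` K)) -> hausdorff_space X.
Proof.
move=> cptY hY cf surj_f clf; rewrite open_hausdorff => u v /eqP uv.
have cl1 (w : X) : closed [set w].
  have [y <-] := surj_f w; rewrite -image_set1.
  by apply/clf/accessible_closed_set1/hausdorff_accessible.
have clR (w : X) : closed (f @^-1` [set w]) by apply: closed_comp => // y _; exact: cf.
have [|C /set_nbhsP[U [oU RU UC]] clC] :=
    @compact_normal Y hY cptY _ (clR u) (~` (f @^-1` [set v])).
  apply/set_nbhsP; exists (~` (f @^-1` [set v])).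
  by split=> //; [exact: closed_openC|move=> y /= -> /uv].
exists (~` (f @` (~` U)), ~` (f @` closure C)); split => /=.
- by rewrite in_setE => -[y /= nUy /RU].
- by rewrite in_setE => -[y /= /clC nyv /nyv].
- exact/closed_openC/clf/open_closedC.
- exact/closed_openC/clf/closed_closure.
apply/eqP/seteqP; split=> // x [nPx nQx]; have [y yx] := surj_f x.
have [Uy|nUy] := pselect (U y); last by apply: nPx; exists y.
by apply: nQx; exists y => //; exact/subset_closure/UC.
Qed.

Lemma closed_sub1 T (x : T) (A : set T) :
  hausdorff_space T -> A `<=` [set x] -> closed A.
Proof.
move=> /hausdorff_accessible/accessible_finite_set_closed clT Ax.
by apply: clT; apply: sub_finite_set Ax _; exact: finite_set1.
Qed.

Lemma closed_imply T (P : Prop) (A : set T) :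
  closed A -> closed [set x | P -> A x].
Proof.
move=> cA; have [p|np] := pselect P.
  by rewrite (_ : mkset _ = A) //; apply/seteqP; split=> x /=; auto.
rewrite (_ : mkset _ = setT); first exact: closedT.
by apply/seteqP; split=> x /= // _ /np.
Qed.

Lemma closed_and T (P : Prop) (A : set T) :
  closed A -> closed [set x | P /\ A x].
Proof.
move=> cA; have [p|np] := pselect P.
  by rewrite (_ : mkset _ = A) //; apply/seteqP; split=> x /=; tauto.
rewrite (_ : mkset _ = set0); first exact: closed0.
by apply/seteqP; split=> x //= -[].
Qed.

Lemma sigT_closed (I : choiceType) (X : I -> topologicalType)
    (K : set {i & X i}) :
  (forall i, closed (existT X i @^-1` K)) -> closed K.
Proof.
move=> cK; rewrite -openC; apply/sigT_openP => i.
by rewrite preimage_setC openC.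
Qed.

End GeneralTopology.

(** * Ordered continua *)

Section OrderedContinuum.
Context {d : Order.disp_t} (L : orderTopologicalType d).
Hypothesis contL : ordered_continuum L.
Implicit Types a b x y z : L.

Local Open Scope order_scope.
Local Open Scope classical_set_scope.

(** Without a first point the open upper rays would cover [L]; but the least of
    the end points of finitely many of them is in none of them. *)
Lemma ordered_continuum_first : exists x : L, is_first x.
Proof.
case: contL => -[x0 _] cL _; apply: contrapT => /forallNP noF.
have [x|x|s sP] := @compact_finite_subcover L L (fun y => `]y, +oo[%classic) cL.
- exact: rray_open.
- have /existsNP[y /negP] := noF x.
  by rewrite -ltNge => yx; exists y; rewrite /= in_itv /= yx.
have [m mP] : exists m, forall y, y \in s -> m <= y.
  elim: (s) => [|y t [m mP]]; first by exists x0.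
  exists (Order.min y m) => z; rewrite inE ge_min => /predU1P[->|/mP->].
    by rewrite lexx.
  by rewrite orbT.
by have [y /mP my] := sP m; rewrite /= in_itv /= andbT ltNge my.
Qed.

Lemma ordered_continuum_last : exists x : L, is_last x.
Proof.
case: contL => -[x0 _] cL _; apply: contrapT => /forallNP noL.
have [x|x|s sP] := @compact_finite_subcover L L (fun y => `]-oo, y[%classic) cL.
- exact: lray_open.
- have /existsNP[y /negP] := noL x.
  by rewrite -ltNge => yx; exists y; rewrite /= in_itv /= yx.
have [m mP] : exists m, forall y, y \in s -> y <= m.
  elim: (s) => [|y t [m mP]]; first by exists x0.
  exists (Order.max y m) => z; rewrite inE le_max => /predU1P[->|/mP->].
    by rewrite lexx.
  by rewrite orbT.
by have [y /mP my] := sP m; rewrite /= in_itv /= ltNge my.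
Qed.

Lemma is_first_unique x y : is_first x -> is_first y -> x = y.
Proof. by move=> fx fy; apply/le_anti; rewrite fx fy. Qed.

Lemma is_last_unique x y : is_last x -> is_last y -> x = y.
Proof. by move=> lx ly; apply/le_anti; rewrite lx ly. Qed.

Lemma first_lt_last x y : is_first x -> is_last y -> x < y.
Proof.
move=> fx ly; rewrite lt_neqAle fx andbT; apply/eqP => xy.
case: contL => -[a [b]] ab _ _; apply: ab; apply/le_anti.
by rewrite (le_trans (ly a)) -?xy // (le_trans (ly b)) -?xy.
Qed.

Lemma first_not_last x : is_first x -> ~ is_last x.
Proof. by move=> fx lx; have := first_lt_last fx lx; rewrite ltxx. Qed.

(** If nothing lay between [a] and [b], the open ray below [b] would be the closed
    ray below [a], hence clopen. *)
Lemma ordered_continuum_dense a b : a < b -> exists x, a < x < b.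
Proof.
case: contL => _ _ cL ab; apply: contrapT => /forallNP noM.
suff ray_all : `]-oo, b[%classic = [set: L].
  have : `]-oo, b[%classic b by rewrite ray_all.
  by rewrite /= in_itv /= ltxx.
apply: cL; first by exists a; rewrite /= in_itv.
- by exists `]-oo, b[; [exact: lray_open|rewrite setTI].
exists `]-oo, a]; first exact: lray_closed.
rewrite setTI; apply/seteqP; split=> x /=; rewrite !in_itv /=.
  by move=> xb; rewrite leNgt; apply/negP => ax; apply: (noM x); rewrite ax.
by move=> /le_lt_trans; apply.
Qed.

(** The interior in [L] of the closed interval from [a] to [b]: an end of the
    interval that is also an end of [L] is an interior point. *)
Definition itv_interior a b : set L :=
  [set v | is_first a \/ a < v] `&` [set v | is_last b \/ v < b].

Lemma itv_interior_open a b : open (itv_interior a b).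
Proof.
apply: openI.
  have [fa|nfa] := pselect (is_first a).
    by rewrite (_ : mkset _ = setT); [exact: openT|apply/seteqP; split=> // v _; left].
  rewrite (_ : mkset _ = `]a, +oo[); first exact: rray_open.
  by apply/seteqP; split=> v /=; rewrite in_itv /= andbT; [case|right].
have [fa|nfa] := pselect (is_last b).
  by rewrite (_ : mkset _ = setT); [exact: openT|apply/seteqP; split=> // v _; left].
rewrite (_ : mkset _ = `]-oo, b[); first exact: lray_open.
by apply/seteqP; split=> v /=; rewrite in_itv /=; [case|right].
Qed.

(** Density leaves room to shrink an open interval to a closed one. *)
Lemma nbhs_itv_interior z (Z : set L) : nbhs z Z ->
  exists a b, itv_interior a b z /\ `[a, b] `<=` Z.
Proof.
rewrite itv_nbhsE => -[[l r] [oi]]; rewrite itv_boundlr => /andP[lz zr] sZ.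
have [a az la] : exists2 a, is_first a \/ a < z & (l <= BLeft a)%O.
  case: l oi lz {sZ} => [[] t|[]] //= oi; last first.
    by have [f fP] := ordered_continuum_first; exists f => //; left.
  rewrite bnd_simp => tz; have [a /andP[ta az]] := ordered_continuum_dense tz.
  by exists a; [right|rewrite bnd_simp].
have [b bz br] : exists2 b, is_last b \/ z < b & (BRight b <= r)%O.
  case: r oi zr {sZ} => [[] t|[]] oi.
  - rewrite bnd_simp => zt; have [b /andP[zb bt]] := ordered_continuum_dense zt.
    by exists b; [right|rewrite bnd_simp].
  - by have := itv_open_ends_rside oi.
  - by have := itv_open_ends_rinfty oi.
  - by have [f fP] := ordered_continuum_last; exists f => //; left.
exists a, b; split=> // v; rewrite /= in_itv /= => /andP[av vb].
apply: sZ; rewrite /= itv_boundlr (le_trans la) ?bnd_simp //=.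
by apply: le_trans br; rewrite bnd_simp.
Qed.

Definition subdivision (m : nat) (x : nat -> L) : Prop :=
  [/\ (0 < m)%N, is_first (x 0%N), is_last (x m)
    & {in [pred i | (i <= m)%N] &, {mono x : i j / (i < j)%N >-> i < j}}].

(** If [G] holds of some interval around each point, a finite subdivision makes [G]
    hold of the union of any two successive edges: by compactness the interiors of
    finitely many intervals where [G] holds cover [L], and all their ends are taken
    as nodes.  The middle node [x i.+1] is interior to one of these intervals; both
    ends of that interval are nodes, so it contains [x i] and [x i.+2].  The
    sequence [F] forces further nodes. *)
Lemma fine_subdivision (G : L -> L -> Prop) (F : seq L) :
  (forall z, exists a b, itv_interior a b z /\ G a b) ->
  (forall a b a' b', a <= a' -> b' <= b -> G a b -> G a' b') ->
  exists (m : nat) (x : nat -> L), [/\ subdivision m x,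
    forall i, (i.+2 <= m)%N -> G (x i) (x i.+2)
    & forall c, c \in F -> exists2 i, (i <= m)%N & x i = c].
Proof.
move=> locG antiG.
(* The finitely many intervals, as pairs of endpoints; indices not satisfying [G]
   get the empty set. *)
have [|||s sP] := @compact_finite_subcover L (L * L)%type
    (fun p => itv_interior p.1 p.2 `&` [set _ | G p.1 p.2]); first by case: contL.
- move=> [a b] /=; have [Gab|nGab] := pselect (G a b).
    rewrite (_ : _ `&` _ = itv_interior a b); first exact: itv_interior_open.
    by apply/seteqP; split=> [v []|v].
  rewrite (_ : _ `&` _ = set0); first exact: open0.
  by apply/seteqP; split=> [v []|v].
- by move=> z; have [a [b ?]] := locG z; exists (a, b).
have [lo loP] := ordered_continuum_first.
have [hi hiP] := ordered_continuum_last.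
pose t := sort <=%O (undup (lo :: hi :: F ++ map fst s ++ map snd s)).
have mem_t c : (c \in t) = (c \in lo :: hi :: F ++ map fst s ++ map snd s).
  by rewrite mem_sort mem_undup.
pose x := nth lo t; pose m := (size t).-1.
have t_gt0 : (0 < size t)%N.
  by have : lo \in t by [rewrite mem_t mem_head]; case: (t).
have ltm i : (i <= m)%N = (i < size t)%N by rewrite /m -ltnS prednK.
have mem_x c : c \in t -> exists2 i, (i <= m)%N & x i = c.
  by move=> ct; exists (index c t); rewrite ?ltm ?index_mem ?/x ?nth_index.
have mono_x : {in [pred i | (i <= m)%N] &, {mono x : i j / (i < j)%N >-> i < j}}.
  move=> i j; rewrite !inE !ltm => it jt.
  by rewrite lt_sorted_ltn_nth // sort_lt_sorted undup_uniq.
have mono_xle : {in [pred i | (i <= m)%N] &, {mono x : i j / (i <= j)%N >-> i <= j}}.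
  by move=> i j im jm; rewrite leNgt mono_x // -leqNgt.
have x0f : is_first (x 0%N).
  have [i im xi] : exists2 i, (i <= m)%N & x i = lo.
    by apply: mem_x; rewrite mem_t mem_head.
  by move=> y; rewrite (le_trans _ (loP y)) // -xi mono_xle.
have xml : is_last (x m).
  have [i im xi] : exists2 i, (i <= m)%N & x i = hi.
    by apply: mem_x; rewrite mem_t !inE eqxx orbT.
  by move=> y; rewrite (le_trans (hiP y)) // -xi mono_xle ?inE.
exists m, x; split.
- split=> //; rewrite lt0n; apply/eqP => m0.
  by apply: (first_not_last x0f); rewrite -m0.
- move=> i im; have [[a b] /= abs [[la lb] Gab]] := sP (x i.+1).
  apply: antiG Gab.
    case: la => [|ax]; first exact.
    have [k km xk] : exists2 k, (k <= m)%N & x k = a.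
      apply: mem_x; rewrite mem_t !inE !mem_cat.
      by rewrite (map_f fst abs) !orbT.
    move: ax; rewrite -xk mono_x ?inE ?(ltnW im) // ltnS => ki.
    by rewrite mono_xle // inE (leq_trans _ im) // leqW.
  case: lb => [|xb]; first exact.
  have [k km xk] : exists2 k, (k <= m)%N & x k = b.
    apply: mem_x; rewrite mem_t !inE !mem_cat.
    by rewrite (map_f snd abs) !orbT.
  by move: xb; rewrite -xk mono_x ?mono_xle ?inE // ltnW.
- by move=> c cF; apply: mem_x; rewrite mem_t !inE mem_cat cF !orbT.
Qed.

End OrderedContinuum.

(** * The circles *)

Lemma glue_openE (T : topologicalType) (R : T -> T -> Prop) (U : set (Defs.glue R)) :
  open U = open (glue_pi R @^-1` U).
Proof. by []. Qed.

Section CircleTopology.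
Context {d : Order.disp_t} (L : orderTopologicalType d).
Hypothesis contL : ordered_continuum L.
Variable n : nat.
Implicit Types (i j : 'I_n) (x y : L).

Definition circle_map (a : copies L n) : circle L n :=
  circle_pt (projT1 a) (projT2 a).

(** A circle, a quotient of a quotient of a disjoint sum, carries the final topology
    of its arcs. *)
Lemma circle_openP (U : set (circle L n)) :
  open U <-> forall i, open (circle_pt i @^-1` U).
Proof. by rewrite !glue_openE sigT_openP. Qed.

Lemma circle_closedP (V : set (circle L n)) :
  closed V <-> forall i, closed (circle_pt i @^-1` V).
Proof.
rewrite -openC circle_openP.
by split=> oV i; have := oV i; rewrite preimage_setC openC.
Qed.

Lemma circle_map_continuous : continuous circle_map.
Proof. by apply/continuousP => U /circle_openP oU; apply/sigT_openP. Qed.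

Lemma circle_map_surj (c : circle L n) : exists a, circle_map a = c.
Proof.
exists (glue_repr (glue_repr c)).
have -> a : circle_map a = glue_pi _ (glue_pi _ a) by case: a.
by rewrite /glue_pi /glue_repr !reprK.
Qed.

Lemma circle_pt_surj (c : circle L n) : exists i x, circle_pt i x = c.
Proof. by have [[i x] <-] := circle_map_surj c; exists i, x. Qed.

(** Indices are compared modulo [n], so that this covers both gluings: that of
    successive arcs and that of the two ends of the chain. *)
Definition seam i x j y : Prop :=
  [/\ is_last x, is_first y & i.+1 = j %[mod n]].

(** A point of the circle as the arc that it starts or is interior to, with its
    position there if it is interior. *)
Let normal_form (a : copies L n) : nat * option L :=
  let: existT i x := a in
  if `[< is_last x >] then (i.+1 %% n, None)
  else (val i, if `[< is_first x >] then None else Some x).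

Let normal_form_last i x : is_last x ->
  normal_form (copy i x) = (i.+1 %% n, None).
Proof. by move=> lx; rewrite /= asboolT. Qed.

Let normal_form_first i x : is_first x ->
  normal_form (copy i x) = (val i, None).
Proof.
move=> fx; rewrite /= asboolF; last exact: first_not_last.
by rewrite asboolT.
Qed.

(** [normal_form] is constant on both kinds of glued pairs, hence on the points of
    the circle, and two copies with the same normal form are equal or form a
    seam. *)
Lemma circle_ptP i x j y : circle_pt i x = circle_pt j y <->
  [\/ i = j /\ x = y, seam i x j y | seam j y i x].
Proof.
have glue_seam k z l w : seam k z l w -> circle_pt k z = circle_pt l w.
  move=> [zl wf]; have n_gt0 : 0 < n by apply: leq_ltn_trans (ltn_ord k).
  have := ltn_ord k; rewrite leq_eqVlt => /predU1P[kn|kn].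
    rewrite kn modnn modn_small // => l0; apply: glue_piP.
    by split; [exists k, z|exists l, w]; split => //; [right|left].
  rewrite !modn_small // => kl; rewrite /circle_pt; congr (glue_pi _ _).
  exact: glue_piP.
split; last by case=> [[-> ->]|/glue_seam|/glue_seam].
suff nfE k z l w : circle_pt k z = circle_pt l w ->
    normal_form (copy k z) = normal_form (copy l w).
  move=> /nfE /=; case: (asboolP (is_last x)) => xl;
    case: (asboolP (is_last y)) => yl nf_eq;
    have := congr1 snd nf_eq; have := congr1 fst nf_eq => /= {nf_eq}.
  - move=> /eqP; rewrite -addn1 -[j.+1]addn1 eqn_modDr !modn_small //.
    move=> /eqP ij _.
    by constructor 1; split; [exact: val_inj|exact: is_last_unique].
  - case: asboolP => // yf ij _; constructor 2; split=> //.
    by rewrite ij modn_small.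
  - case: asboolP => // xf ij _; constructor 3; split=> //.
    by rewrite -ij modn_small.
  - move=> /val_inj ij xy; constructor 1; split=> //.
    move: xy; case: asboolP => xf; case: asboolP => yf //; last by case.
    by move=> _; exact: is_first_unique.
have nf_seq a b : consecutive_ends a b -> normal_form a = normal_form b.
  case: a b => [s z'] [t w'] [zl wf st]; rewrite /= in zl wf st.
  rewrite -/(copy s z') -/(copy t w') normal_form_last // normal_form_first //.
  by rewrite st modn_small.
(* Both quotients are left in turn: [g] is [normal_form] on the chain. *)
pose g (c : chain L n) := normal_form (glue_repr c).
have gE s z' : g (chain_pt s z') = normal_form (copy s z').
  exact: glue_repr_lift nf_seq.
have gb a b : both_ends a b -> g a = g b.
  suff bE c : chain_boundary c -> g c = (0, None) by move=> [/bE-> /bE->].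
  move=> [s [z' [-> sz]]]; rewrite gE; case: sz => [[s0 zf]|[sn zl]].
    by rewrite normal_form_first //= s0.
  by rewrite normal_form_last // sn modnn.
move=> /(congr1 (g \o (@glue_repr _ _))) /=.
by rewrite !(@glue_repr_lift _ _ _ g _ gb) !gE.
Qed.

(** On each arc, the saturation of [K] adds to [K] at most the last point (glued to
    the first point of the next arc) and the first point. *)
Lemma circle_map_closed (K : set (copies L n)) :
  closed K -> closed (circle_map @` K).
Proof.
move=> clK; apply/circle_closedP => i.
pose A := [set x | exists j y, K (copy j y) /\ seam i x j y].
pose B := [set x | exists j y, K (copy j y) /\ seam j y i x].
rewrite (_ : _ @^-1` _ = copy i @^-1` K `|` A `|` B).
  have hL : hausdorff_space L := order_hausdorff.
  have [[lo loP] [hi hiP]] :=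
    (ordered_continuum_first contL, ordered_continuum_last contL).
  apply: closedU; first apply: closedU.
  - by apply: closed_comp => // x _; exact: existT_continuous.
  - apply: (@closed_sub1 _ hi) => // x [j [y [_ [xl _ _]]]].
    exact: is_last_unique.
  - apply: (@closed_sub1 _ lo) => // x [j [y [_ [_ xf _]]]].
    exact: is_first_unique.
apply/seteqP; split=> x /=.
  move=> [[j y] Ky /circle_ptP[[<- <-]|s|s]]; first by left; left.
    by right; exists j, y.
  by left; right; exists j, y.
move=> [[Kx|[j [y [Ky s]]]]|[j [y [Ky s]]]]; first by exists (copy i x).
  by exists (copy j y) => //; apply/circle_ptP; constructor 3.
by exists (copy j y) => //; apply/circle_ptP; constructor 2.
Qed.

Lemma copies_compact : compact [set: copies L n].
Proof. by apply: sigT_compact => [|_]; [exact: finite_finset|case: contL]. Qed.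

Lemma circle_compact : compact [set: circle L n].
Proof.
rewrite (_ : [set: _] = circle_map @` setT).
  apply: continuous_compact copies_compact.
  exact/continuous_subspaceT/circle_map_continuous.
by apply/seteqP; split=> // c _; have [a] := circle_map_surj c; exists a.
Qed.

Lemma circle_hausdorff : hausdorff_space (circle L n).
Proof.
apply: (@closed_map_hausdorff _ _ circle_map) circle_map_surj circle_map_closed.
- exact: copies_compact.
- by apply: sigT_hausdorff => _; exact: order_hausdorff.
- exact: circle_map_continuous.
Qed.

End CircleTopology.
Arguments circle_map {d L n} a.

Lemma circle_cover_continuous (d : Order.disp_t) (L : orderTopologicalType d)
  (m n : nat) : continuous (@circle_cover d L m n).
Proof.
apply/continuousP => U oU; apply/circle_openP => i.
rewrite (_ : _ @^-1` _ = circle_pt (ord_mod i) @^-1` U).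
  by move/circle_openP : oU.
by apply/seteqP; split=> x /=; rewrite circle_coverE.
Qed.

Lemma circle_pt_closed (d : Order.disp_t) (L : orderTopologicalType d) (n : nat)
    (i : 'I_n) (K : set L) :
  ordered_continuum L -> closed K -> closed (circle_pt i @` K).
Proof.
move=> contL cK.
rewrite (_ : _ @` _ = circle_map @`
    [set c : copies L n | projT1 c = i /\ K (projT2 c)]).
  apply: circle_map_closed => //; apply: sigT_closed => l.
  have : closed [set x : L | l = i /\ K x] by apply: (closed_and cK).
  by [].
apply/seteqP; split=> [_ [x Kx <-]|_ [[l x] [/= -> Kx] <-]]; last by exists x.
by exists (copy i x).
Qed.

Section Separation.
Context {d : Order.disp_t} (L : orderTopologicalType d).
Hypothesis contL : ordered_continuum L.

(** The lifts of [circle_pt j y] cut the [m]-fold cover into arcs of one turn.  [P]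
    is the closed arc from the lift [(j, y)] to the next lift [(j + n, y)], and [Q]
    is the union of the others; they meet only over [circle_pt j y].  The points
    [(i, x)] and [(i + n, x)] are one turn apart, so one of them is in [P] and
    the other in [Q]: [i] and [j] are below [n], hence [(j, y)] lies between the two
    points or [(j + n, y)] does. *)
Lemma circle_cover_separation (m n : nat) (i j : 'I_n) (a b : 'I_(m * n))
    (x y : L) :
  1 < m -> a = i :> nat -> b = i + n :> nat ->
  circle_pt i x <> circle_pt j y ->
  exists P Q : set (circle L (m * n)),
    [/\ closed P, closed Q, P `|` Q = setT,
      forall c, P c -> Q c -> circle_cover c = circle_pt j y
    & P (circle_pt a x) /\ Q (circle_pt b x) \/
      P (circle_pt b x) /\ Q (circle_pt a x)].
Proof.
move=> m_gt1 ai bi xy; have [i_lt j_lt] := (ltn_ord i, ltn_ord j).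
have le2n : n + n <= m * n by rewrite addnn -mul2n leq_mul2r m_gt1 orbT.
(* [j + n] is below [m * n]: this arc does not pass the point where the numbering
   of the arcs starts again from 0. *)
pose arc : set (copies L (m * n)) := [set c : copies L (m * n) |
  (j <= projT1 c <= j + n /\ (projT1 c = j :> nat -> (y <= projT2 c)%O)) /\
  (projT1 c = j + n :> nat -> (projT2 c <= y)%O)].
pose coarc : set (copies L (m * n)) := [set c : copies L (m * n) |
  [\/ ~ (j <= projT1 c <= j + n),
      projT1 c = j :> nat /\ (projT2 c <= y)%O
    | projT1 c = j + n :> nat /\ (y <= projT2 c)%O]].
have cl_le : closed [set z : L | (z <= y)%O].
  rewrite (_ : mkset _ = `]-oo, y]); first exact: lray_closed.
  by apply/seteqP; split=> z; rewrite /= in_itv.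
have cl_ge : closed [set z : L | (y <= z)%O].
  rewrite (_ : mkset _ = `[y, +oo[); first exact: rray_closed.
  by apply/seteqP; split=> z; rewrite /= in_itv /= andbT.
have fibre (l : 'I_(m * n)) z : l = j :> nat \/ l = j + n :> nat -> y = z ->
    circle_cover (circle_pt l z) = circle_pt j y.
  move=> lj <-; rewrite circle_coverE; congr circle_pt; apply: val_inj => /=.
  by case: lj => ->; rewrite ?modnDr modn_small.
exists (circle_map @` arc), (circle_map @` coarc); split.
- apply: circle_map_closed => //; apply: sigT_closed => l /=.
  rewrite (_ : _ @^-1` _ =
      [set z : L | j <= l <= j + n /\ [set z : L | l = j :> nat -> (y <= z)%O] z] `&`
      [set z : L | l = j + n :> nat -> (z <= y)%O]) //.
  apply: closedI; last by apply: (closed_imply cl_le).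
  by apply: closed_and; apply: (closed_imply cl_ge).
- apply: circle_map_closed => //; apply: sigT_closed => l /=.
  rewrite (_ : _ @^-1` _ = [set z | ~ (j <= l <= j + n) /\ setT z] `|`
     ([set z : L | l = j :> nat /\ (z <= y)%O] `|`
     [set z | l = j + n :> nat /\ (y <= z)%O])).
    apply: closedU; first by apply: (@closed_and _ _ setT); exact: closedT.
    by apply: closedU; apply: closed_and.
  apply/seteqP; split=> z /=.
    by case=> [?|?|?]; [left|right; left|right; right].
  by case=> [[? _]|[?|?]]; [constructor 1|constructor 2|constructor 3].
- apply/seteqP; split=> // c _; have [[l z] <-] := circle_map_surj c.
  have [arc_lz|narc] := pselect (arc (existT _ l z)); first by left; exists (existT _ l z).
  right; exists (existT _ l z) => //; rewrite /coarc /=.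
  have [jl|] := boolP (j <= l <= j + n); last by move/negP; constructor 1.
  have [yz|zy] := leP y z.
    have [lE|lN] := eqVneq (l : nat) (j + n); first by constructor 3.
    by exfalso; apply: narc; do ![split] => //= lE; rewrite lE eqxx in lN.
  have [lE|lN] := eqVneq (l : nat) j; first by constructor 2; split=> //; exact: ltW.
  exfalso; apply: narc; do ![split] => //= lE; first by rewrite lE eqxx in lN.
  exact: ltW.
- move=> _ [[l z] arc_lz <-] [[l' z'] coarc_lz].
  rewrite /circle_map /=; have [/= [jl ly] lny] := arc_lz.
  have [lt_l lt_l'] := (ltn_ord l, ltn_ord l').
  rewrite /coarc /= in coarc_lz.
  move/circle_ptP => /(_ contL) [[l'l z'z]|[z'l zf l'l]|[zl z'f ll']].
  + rewrite {l' lt_l'}l'l {z'}z'z in coarc_lz.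
    case: coarc_lz => [//|[lE zy]|[lE yz]]; apply: fibre; try by [left|right].
      by apply/le_anti; rewrite zy ly.
    by apply/le_anti; rewrite yz lny.
  + have [lE|lN] := eqVneq (l : nat) j.
      by apply: fibre; [left|apply/le_anti; rewrite ly // zf].
    have l'E : l'.+1 = l.
      move: l'l; case: (ltnP l'.+1 (m * n)) => [lt_l'S|ge_l'S].
        by rewrite !modn_small.
      have -> : l'.+1 = m * n by lia.
      by rewrite modnn modn_small //; lia.
    case: coarc_lz => [|[l'j zy]|[l'jn _]]; [lia| |lia].
    rewrite [circle_pt l z](_ : _ = circle_pt l' z'); last first.
      by apply/circle_ptP => //; constructor 3; split.
    by apply: fibre; [left|apply/le_anti; rewrite zy z'l].
  + have [lE|lN] := eqVneq (l : nat) (j + n).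
      by apply: fibre; [right|apply/le_anti; rewrite lny // zl].
    have l'E : l.+1 = l' by move: ll'; rewrite !modn_small //; lia.
    case: coarc_lz => [|[l'j _]|[l'jn yz]]; [lia|lia|].
    rewrite [circle_pt l z](_ : _ = circle_pt l' z'); last first.
      by apply/circle_ptP => //; constructor 2; split.
    by apply: fibre; [right|apply/le_anti; rewrite yz z'f].
- have aE : circle_pt a x = circle_map (existT _ a x) by [].
  have bE : circle_pt b x = circle_map (existT _ b x) by [].
  rewrite aE bE.
  have [ltij|ltji|eqij] := ltngtP i j.
  + right; split; [exists (existT _ b x)|exists (existT _ a x)] => //=.
      by do ![split] => /=; lia.
    by constructor 1; rewrite /=; lia.
  + left; split; [exists (existT _ a x)|exists (existT _ b x)] => //=.
      by do ![split] => /=; lia.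
    by constructor 1; rewrite /=; lia.
  + have ij : i = j by apply: val_inj.
    have [ltxy|ltyx|eqxy] := ltgtP x y.
    * right; split; [exists (existT _ b x)|exists (existT _ a x)] => //=.
        by do ![split] => /=; [lia|lia|move=> _; exact: ltW].
      by constructor 2; rewrite /= ai; split; [lia|exact: ltW].
    * left; split; [exists (existT _ a x)|exists (existT _ b x)] => //=.
        by do ![split] => /=; [lia|move=> _; exact: ltW|lia].
      by constructor 3; rewrite /= bi; split; [lia|exact: ltW].
    * by case: xy; rewrite ij eqxy.
Qed.
End Separation.

(** * The solenoid is a continuum *)

Section SolenoidTopology.
Context {d : Order.disp_t} (L : orderTopologicalType d) (p : nat -> nat).
Hypotheses (contL : ordered_continuum L) (p_gt1 : forall n, 1 < p n).
Local Notation k := (partial_prod p).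
Local Notation S := (solenoid L p).
Implicit Types (s t : S) (x y : L).

Lemma partial_prod_gt0 n : 0 < k n.
Proof. by elim: n => //= n IHn; rewrite muln_gt0 IHn (ltnW (p_gt1 n)). Qed.

Definition coord n s : circle L (k n) := set_val s n.

Lemma coord_cover n s : circle_cover (coord n.+1 s) = coord n s.
Proof. exact: (set_valP s). Qed.

Lemma coord_inj s t : (forall n, coord n s = coord n t) -> s = t.
Proof. by move=> st; apply/val_inj/functional_extensionality_dep. Qed.

Lemma eq_coord_le n m s t : n <= m -> coord m s = coord m t ->
  coord n s = coord n t.
Proof.
move=> /subnKC <-; elim: (m - n) => [|r IHr]; first by rewrite addn0.
by rewrite addnS => st; apply: IHr; rewrite -(coord_cover _ s) -(coord_cover _ t) st.
Qed.

Lemma coord_continuous n : continuous (coord n).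
Proof.
move=> s; apply: (@continuous_comp _ _ _ (set_val : S -> _)
  (fun f : prod_topology (fun n => circle L (k n)) => f n)).
  exact: initial_continuous.
exact: proj_continuous.
Qed.

Lemma open_coord_le n m (U : set (circle L (k n))) : n <= m -> open U ->
  exists2 V : set (circle L (k m)), open V &
    forall s, V (coord m s) <-> U (coord n s).
Proof.
move=> /subnKC <- oU; elim: (m - n) => [|r [V oV VU]].
  by rewrite addn0; exists U.
rewrite addnS; exists (@circle_cover _ L (p (n + r)) (k (n + r)) @^-1` V).
  by apply: open_comp => // c _; exact: circle_cover_continuous.
by move=> s; rewrite -(VU s) -(coord_cover (n + r) s).
Qed.

(** Finitely many conditions on coordinates amount to one on the highest of them,
    which determines the others continuously. *)
Lemma nbhs_solenoid s (O : set S) : nbhs s O ->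
  exists n (U : set (circle L (k n))),
    [/\ open U, U (coord n s) & coord n @^-1` U `<=` O].
Proof.
move=> [_ [[W oW <-] Ws WO]].
pose F : set_system (prod_topology (fun n => circle L (k n))) :=
  filter_from [set nU : {n & set (circle L (k n))} |
      open (projT2 nU) /\ projT2 nU (coord (projT1 nU) s)]
    (fun nU => set_val @` (coord (projT1 nU) @^-1` projT2 nU)).
have FF : Filter F.
  apply: filter_from_filter.
    by exists (existT (fun n => set (circle L (k n))) 0 setT); split => //; exact: openT.
  move=> [n U] [m V] [/= oU Us] [/= oV Vs].
  have [U' oU' U'P] := open_coord_le (leq_maxl n m) oU.
  have [V' oV' V'P] := open_coord_le (leq_maxr n m) oV.
  exists (existT (fun n => set (circle L (k n))) (maxn n m) (U' `&` V')).
    by split=> /=; [exact: openI|split; [rewrite U'P|rewrite V'P]].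
  by move=> _ [t [/U'P Ut /V'P Vt] <-]; split; exists t.
(* The filter [F] generated by the cylinders around [s] converges to [s] in the
   product, because it does so coordinatewise. *)
have /(_ W) [|[n U] [oU Us] UW] : F --> set_val s.
- apply/cvg_sup => n A [_ [[V oV <-] Vs VA]].
  exists (existT (fun n => set (circle L (k n))) n V) => //.
  by move=> _ [t Vt <-]; exact: VA.
- exact: open_nbhs_nbhs.
by exists n, U; split=> // t Ut; apply: WO; apply: UW; exists t.
Qed.

Lemma solenoid_hausdorff : hausdorff_space S.
Proof.
apply: (@hausdorff_inj _ _ (set_val : S -> _)).
- exact: initial_continuous.
- exact: val_inj.
by apply: hausdorff_product => n; exact: circle_hausdorff.
Qed.

Lemma solenoid_compact : compact [set: S].
Proof.
apply: compact_set_type.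
have cptP : compact [set: prod_topology (fun n => circle L (k n))].
  have := tychonoff (fun n => circle_compact contL (n := k n)).
  by congr compact; apply/seteqP.
apply: subclosed_compact cptP _ => //.
suff : closed (\bigcap_n [set f : prod_topology (fun n => circle L (k n)) |
    @circle_cover _ L (p n) (k n) (f n.+1) = f n]).
  by congr closed; apply/seteqP; split=> [f fP n|f fP n _]; exact: fP.
apply: closed_bigI => n _.
apply: closed_equalizer; last exact: circle_hausdorff.
  move=> f; apply: (@continuous_comp _ _ _
      (fun f : prod_topology (fun n => circle L (k n)) => f n.+1)).
    exact: proj_continuous.
  exact: circle_cover_continuous.
exact: proj_continuous.
Qed.

Fact wind_subproof (q : nat) (x : L) :
  (fun n => circle_pt (Ordinal (ltn_pmod q (partial_prod_gt0 n))) x)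
    \in inverse_limit (fun n => @circle_cover _ L (p n) (k n)).
Proof.
apply: mem_set => n; rewrite [LHS]circle_coverE.
by congr circle_pt; apply: val_inj; rewrite /= modn_dvdm // dvdn_mull.
Qed.

(** The point at position [x] on the [q]-th arc of a line that winds around all
    the circles at once. *)
Definition wind (q : nat) (x : L) : S := SigSub (wind_subproof q x).

Lemma coord_wind n q x (i : 'I_(k n)) : q = i %[mod k n] ->
  coord n (wind q x) = circle_pt i x.
Proof.
move=> qi; rewrite /coord /wind /=.
by congr circle_pt; apply: val_inj; rewrite /= qi modn_small.
Qed.

Lemma wind_succ q x y : is_last x -> is_first y -> wind q x = wind q.+1 y.
Proof.
move=> xl yf; apply: coord_inj => n.
have q_lt r := ltn_pmod r (partial_prod_gt0 n).
rewrite (@coord_wind _ _ _ (Ordinal (q_lt q))) ?(@coord_wind _ _ _ (Ordinal (q_lt q.+1)));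
  rewrite ?modn_mod //.
apply/circle_ptP => //; constructor 2; split=> //=.
by rewrite -addn1 modnDml modn_mod addn1.
Qed.

Lemma coord_surj n (c : circle L (k n)) : exists s, coord n s = c.
Proof.
by have [i [x <-]] := circle_pt_surj c; exists (wind i x); exact: coord_wind.
Qed.

Lemma wind_continuous q : continuous (wind q).
Proof.
move=> x O /nbhs_solenoid[n [U [oU Ux UO]]].
have qP : q = Ordinal (ltn_pmod q (partial_prod_gt0 n)) %[mod k n].
  by rewrite /= modn_mod.
rewrite (coord_wind _ qP) in Ux.
apply: (@filterS _ (nbhs x) _
    (circle_pt (Ordinal (ltn_pmod q (partial_prod_gt0 n))) @^-1` U)).
  by move=> y Uy; apply: UO; rewrite /= (coord_wind _ qP).
by apply: open_nbhs_nbhs; split => //; move/circle_openP : oU.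
Qed.

(** The line of all [wind q x] is connected because successive arcs share an end, and
    dense because it meets every fibre of every [coord n]. *)
Lemma solenoid_connected : connected [set: S].
Proof.
have [[lo loP] [hi hiP]] :=
  (ordered_continuum_first contL, ordered_continuum_last contL).
have cW q : connected (range (wind q)).
  apply: connected_continuous_connected; first by case: contL.
  exact/continuous_subspaceT/wind_continuous.
pose line q := \bigcup_(r in `I_q.+1) range (wind r).
have cline q : connected (line q).
  elim: q => [|q IHq]; rewrite /line; last first.
    rewrite IIS bigcup_setU bigcup_set1; apply: connectedU => //.
    exists (wind q.+1 lo); split; last by exists lo.
    by exists q => //=; exists hi => //; exact: wind_succ.
  by rewrite IIS bigcup_setU bigcup_set1 II0 bigcup_set0 set0U.
suff <- : closure (\bigcup_q line q) = [set: S].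
  apply/connected_closure/bigcup_connected => //.
  by exists (wind 0 lo) => q _; exists 0 => //; exists lo.
apply/seteqP; split=> // s _ O /nbhs_solenoid[n [U [_ Us UO]]].
have [i [x ix]] := circle_pt_surj (coord n s).
exists (wind i x); split; last by apply: UO; rewrite /= (@coord_wind _ _ _ i) ?ix.
by exists i => //; exists i => //=; exists x.
Qed.

Lemma solenoid_continuum : continuum S.
Proof.
split; [|exact: solenoid_compact|exact: solenoid_connected
  |exact: solenoid_hausdorff].
by have [lo _] := ordered_continuum_first contL; exists (wind 0 lo).
Qed.

End SolenoidTopology.

(** * Indecomposability *)

Section Indecomposable.
Context {d : Order.disp_t} (L : orderTopologicalType d) (p : nat -> nat).
Hypotheses (contL : ordered_continuum L) (p_gt1 : forall n, 1 < p n).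
Local Notation k := (partial_prod p).
Local Notation S := (solenoid L p).
Local Notation wind := (wind p_gt1).

(** A subcontinuum is closed, so a basic neighbourhood of a point outside it is
    outside as well.  The fibre of that point over any higher level is smaller still,
    which lets two subcontinua be compared at a common level. *)
Lemma proper_subcontinuum_misses_fibre (A : set S) :
  subcontinuum A -> A <> [set: S] ->
  exists n s, forall m t, n <= m -> coord m t = coord m s -> ~ A t.
Proof.
move=> [_ cptA _] AT.
have [s nAs] : exists s, ~ A s.
  apply: contrapT => /forallNP allA; apply: AT; apply/seteqP; split=> // s _.
  exact: contrapT.
have clA : closed A by apply: compact_closed cptA; exact: solenoid_hausdorff.
have /(nbhs_solenoid)[n [U [_ Us UA]]] : nbhs s (~` A).
  by apply: open_nbhs_nbhs; split => //; exact: closed_openC.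
exists n, s => m t nm /(eq_coord_le nm) ts.
by apply: UA; rewrite /= ts.
Qed.

(** Over one level [n], [A] misses the fibre of [circle_pt i x] and [B] that of
    [circle_pt j y].  Then [B] contains the points [t] and [t'] over
    [circle_pt i x], whose next coordinates the lifts of [circle_pt j y]
    separate. *)
Lemma solenoid_indecomposable : indecomposable S.
Proof.
move=> [A [B [[sA AT] [sB BT] ABT]]].
have [nA [sa missA]] := proper_subcontinuum_misses_fibre sA AT.
have [nB [sb missB]] := proper_subcontinuum_misses_fibre sB BT.
pose n := maxn nA nB.
have [i [x ix]] := circle_pt_surj (coord n sa).
have [j [y jy]] := circle_pt_surj (coord n sb).
have inB t : coord n t = circle_pt i x -> B t.
  rewrite ix => ti; have [At|//] : (A `|` B) t by rewrite ABT.
  by case: (missA n t) => //; exact: leq_maxl.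
have offB t : coord n t = circle_pt j y -> ~ B t.
  by rewrite jy; apply: missB; exact: leq_maxr.
have [i_lt kn_gt0] := (ltn_ord i, partial_prod_gt0 p_gt1 n).
have le2k : k n + k n <= k n.+1 by rewrite addnn -mul2n leq_mul2r p_gt1 orbT.
have a_lt : i < k n.+1 by lia.
have b_lt : i + k n < k n.+1 by lia.
pose t := wind i x; pose t' := wind (i + k n) x.
have tn : coord n t = circle_pt i x by exact: coord_wind.
have t'n : coord n t' = circle_pt i x by apply: coord_wind; rewrite modnDr.
have tS : coord n.+1 t = circle_pt (Ordinal a_lt) x by exact: coord_wind.
have t'S : coord n.+1 t' = circle_pt (Ordinal b_lt) x by exact: coord_wind.
have ijxy : circle_pt i x <> circle_pt j y.
  by move=> ij; apply: (offB t); [rewrite tn|exact: inB].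
have [P [Q [cP cQ PQT PQ0 ends]]] := @circle_cover_separation _ L contL
  (p n) (k n) i j (Ordinal a_lt) (Ordinal b_lt) x y (p_gt1 n) erefl erefl ijxy.
have BPQ : B `&` (coord n.+1 @^-1` P `&` coord n.+1 @^-1` Q) = set0.
  apply/seteqP; split=> // u [Bu [Pu Qu]]; apply: (offB u) => //.
  by rewrite -(coord_cover n u); exact: PQ0.
have BP : B `&` coord n.+1 @^-1` P !=set0 -> B `<=` coord n.+1 @^-1` P.
  have cl (V : set (circle L (k n.+1))) : closed V -> closed (coord n.+1 @^-1` V).
    by move=> cV; apply: closed_comp cV => u _; exact: coord_continuous.
  apply: connected_sub_closed BPQ; [by case: sB|exact: cl|exact: cl|].
  by move=> u _; rewrite -preimage_setU [_ `|` _]PQT.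
have [Bt Bt'] := (inB t tn, inB t' t'n).
case: ends => [[Pa Qb]|[Pb Qa]].
  have Pb : P (coord n.+1 t').
    by apply: BP => //; exists t; split => //; rewrite /= tS.
  by rewrite -[False]/(set0 t') -BPQ; split=> //; split => //; rewrite /= t'S.
have Pa : P (coord n.+1 t).
  by apply: BP => //; exists t'; split => //; rewrite /= t'S.
by rewrite -[False]/(set0 t) -BPQ; split=> //; split => //; rewrite /= tS.
Qed.

End Indecomposable.

(** * Circular chains *)

Definition same_or_next (N : nat) (l l' : 'I_N) : Prop :=
  l' = l \/ l' = l.+1 %[mod N].

(** Finitely many closed edges in cyclic order turn into a circular chain of open
    links, provided that each point lies on an edge and on no others except the
    next one, and that each edge has a point of its own. *)
Section ChainOfEdges.
Context {T : topologicalType} {N : nat} (E : 'I_N -> set T).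

Hypothesis closed_edge : forall l, closed (E l).
Hypothesis edge_cover :
  forall x, exists2 l, E l x & forall l', E l' x -> same_or_next l l'.
Hypothesis edge_private : forall l, exists x, forall l', E l' x <-> l' = l.

Definition edge_star (l : 'I_N) : set T :=
  [set x | forall l', E l' x -> same_or_next l l'].

(** The complement of a star is the union of the other edges, finitely many closed
    sets. *)
Lemma edge_star_open l : open (edge_star l).
Proof.
rewrite -closedC (_ : ~` _ =
  \bigcup_(l' in [set l' | ~ same_or_next l l']) E l').
  by apply: closed_bigcup => //; exact: finite_finset.
apply/seteqP; split=> x /=.
  by move=> /existsNP[l' /not_implyP[El'x nll']]; exists l'.
by move=> [l' nll' El'x] /(_ _ El'x).
Qed.

Lemma edge_star_cover : \bigcup_l edge_star l = setT.
Proof.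
by apply/seteqP; split=> // x _; have [l _ lx] := edge_cover x; exists l.
Qed.

(** The star of [l] lies on the edges [l] and [l + 1], and contains the private
    points of both.  So two stars meet exactly when they have an edge in common. *)
Lemma edge_star_circular : circular_chain edge_star.
Proof.
move=> i j; split=> [[x [xi xj]]|ij].
  have [l Elx _] := edge_cover x.
  have succ_inj (a b : nat) : a.+1 = b.+1 %[mod N] -> a = b %[mod N].
    by move=> /eqP; rewrite -addn1 -[b.+1]addn1 eqn_modDr => /eqP.
  case: (xi l Elx) (xj l Elx) => [->|li] [<-|lj].
  - by constructor 1.
  - by constructor 2.
  - by constructor 3; rewrite li.
  - by constructor 1; apply: succ_inj; rewrite -li.
have [l [li lj]] : exists l, same_or_next i l /\ same_or_next j l.
  case: ij => [ij|ij|ij].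
  - by exists i; split; left=> //; apply: val_inj; move: ij; rewrite !modn_small.
  - by exists i; split; [left|right].
  - by exists j; split; [right|left].
by have [x xl] := edge_private l; exists x; split=> l' /xl ->.
Qed.

End ChainOfEdges.

(** * The solenoid is circle-like *)

Section CircleLike.
Context {d : Order.disp_t} (L : orderTopologicalType d) (p : nat -> nat).
Hypotheses (contL : ordered_continuum L) (p_gt1 : forall n, 1 < p n).
Local Notation k := (partial_prod p).
Local Notation S := (solenoid L p).
Local Notation wind := (wind p_gt1).
Implicit Types (s t : S) (x : nat -> L) (z : L).

Definition small (C : set (set S)) n (A : set (circle L (k n))) : Prop :=
  exists2 V, C V & coord n @^-1` A `<=` V.

(** The sets of points around which some cylinder over level [n] is small are open,
    grow with [n] and cover the solenoid; by compactness one of them is everything. *)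
Lemma open_cover_level (C : set (set S)) : (forall V, C V -> open V) ->
  \bigcup_(V in C) V = [set: S] ->
  exists n, forall c : circle L (k n),
    exists U, [/\ open U, U c & small C U].
Proof.
move=> oC covC.
pose good n := [set s | exists U : set (circle L (k n)),
  [/\ open U, U (coord n s) & small C U]].
have [|n|s|ns nsP] := @compact_finite_subcover S nat good.
- exact: solenoid_compact.
- rewrite openE => s [U [oU Us smU]].
  apply: (@filterS _ (nbhs s) _ (coord n @^-1` U)); first by move=> t Ut; exists U.
  by apply: coord_continuous; exact: open_nbhs_nbhs.
- have [V CV Vs] : (\bigcup_(V in C) V) s by rewrite covC.
  have /nbhs_solenoid[n [U [oU Us UV]]] : nbhs s V.
    by apply: open_nbhs_nbhs; split => //; exact: oC.
  by exists n, U; split=> //; exists V.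
have [m mP] : exists m, forall n, n \in ns -> n <= m.
  by exists (\max_(n <- ns) n) => n nns; exact: (@leq_bigmax_seq _ ns xpredT id).
exists m => c; have [s <-] := coord_surj p_gt1 c.
have [n /mP nm [U [oU Us [V CV UV]]]] := nsP s.
have [W oW WP] := open_coord_le nm oU.
exists W; split=> //; first exact/WP.
by exists V => // t /WP /UV.
Qed.

Lemma edge_arc_subproof n m (l : 'I_(k n * m)) : l %/ m < k n.
Proof.
have m_gt0 : 0 < m by case: m l => // -[l]; rewrite muln0.
by rewrite ltn_divLR.
Qed.

(** On every arc of the circle at level [n] the [m] edges of one subdivision of [L]
    are taken, so that the edge numbered [l = i * m + r] is the [r]-th of arc [i],
    and [l + 1], modulo [k n * m], is the number of the edge after it. *)
Definition edge_arc n m (l : 'I_(k n * m)) : 'I_(k n) :=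
  Ordinal (edge_arc_subproof l).

Definition edge n m x (l : 'I_(k n * m)) : set S := coord n @^-1`
  (circle_pt (edge_arc l) @` [set z | (x (l %% m) <= z <= x (l %% m).+1)%O]).

Lemma edge_closed n m x (l : 'I_(k n * m)) : closed (edge x l).
Proof.
apply: closed_comp => [s _|]; first exact: coord_continuous.
apply: circle_pt_closed => //.
rewrite (_ : mkset _ = `[x (l %% m), x (l %% m).+1]); first exact: itv_closed.
by apply/seteqP; split=> z; rewrite /= in_itv.
Qed.

Lemma circle_pt_not_first n (c : circle L (k n)) :
  exists i z, circle_pt i z = c /\ ~ is_first z.
Proof.
have [i [z <-]] := circle_pt_surj c.
have [zf|zNf] := pselect (is_first z); last by exists i, z.
have [hi hiP] := ordered_continuum_last contL.
exists (ord_pred i), hi; split; last by move=> /(first_not_last contL).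
apply/circle_ptP => //; constructor 2; split => //.
by have /(congr1 val) /= := ord_predK i => ->; rewrite modn_small.
Qed.

Section Edges.
Variables (n m : nat) (x : nat -> L).
Hypothesis subx : subdivision m x.
Implicit Types l : 'I_(k n * m).

Let xlt i j : i <= m -> j <= m -> (x i < x j)%O = (i < j).
Proof. by move=> im jm; have [_ _ _ xP] := subx; rewrite xP ?inE. Qed.

Let xle i j : i <= m -> j <= m -> (x i <= x j)%O = (i <= j).
Proof. by move=> im jm; rewrite leNgt xlt // -leqNgt. Qed.

Let m_gt0 : 0 < m. Proof. by case: subx. Qed.

Let edge_num (i : 'I_(k n)) r : r < m -> exists l,
  [/\ l = i * m + r :> nat, edge_arc l = i & l %% m = r].
Proof.
move=> rm; have lt_l : i * m + r < k n * m by have := ltn_ord i; nia.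
exists (Ordinal lt_l); split=> //=; last by rewrite modnMDl modn_small.
by apply: val_inj; rewrite /= divnMDl // divn_small // addn0.
Qed.

Lemma subdivision_locate z : ~ is_first z ->
  exists2 r, r < m & (x r < z <= x r.+1)%O.
Proof.
move=> zNf; have [_ x0f xml _] := subx.
have exi : exists i, (z <= x i)%O by exists m; exact: xml.
case: (ex_minnP exi) => -[|r] zr minr.
  by case: zNf => y; exact: le_trans zr (x0f y).
exists r; first by apply: minr; exact: xml.
by rewrite zr andbT ltNge; apply/negP => /minr; rewrite ltnn.
Qed.

(** Represent [s] by a position that is not the start of its arc, and let [l] be the
    edge containing it other than as its left end.  Any other edge through [s]
    then starts at [s], so it is the next one, possibly on the next arc. *)
Lemma edge_adjacent s : exists2 l, edge x l s &
  forall l', edge x l' s -> same_or_next l l'.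
Proof.
have [_ x0f xml _] := subx.
have [i [z [iz zNf]]] := circle_pt_not_first (coord n s).
have [r rm /andP[xrz zxr]] := subdivision_locate zNf.
have [l [lE li lr]] := edge_num i rm.
exists l; first by rewrite /edge /= li lr -iz; exists z => //; rewrite /= zxr ltW.
move=> l' [z' /andP[xz' zx']]; rewrite -iz.
have r'm : l' %% m < m by rewrite ltn_mod.
have l'E := divn_eq l' m.
move/circle_ptP => /(_ contL) [[l'i z'z]|[z'l zf _]|[zl z'f il']].
- have l'i' : l' %/ m = i by rewrite -l'i.
  rewrite {z'}z'z in xz' zx'.
  have rr' : r < (l' %% m).+1 by rewrite -xlt // ?(lt_le_trans xrz) // ltnW.
  have r'r : l' %% m <= r.+1 by rewrite -xle // ?(le_trans xz') // ltnW.
  have [r'E|r'N] := eqVneq (l' %% m) r.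
    by left; apply: val_inj; rewrite /= l'E l'i' lE r'E.
  by right; rewrite lE l'E l'i' (_ : l' %% m = r.+1) ?addnS //; lia.
- by case: zNf.
have rE : r.+1 = m.
  apply/eqP; rewrite eqn_leq rm leqNgt; apply/negP => rm'.
  have : (x r.+1 < x m)%O by rewrite xlt.
  by rewrite ltNge (le_trans (zl _)).
have r'E : l' %% m = 0.
  by apply/eqP; rewrite -leqn0 -xle // ?(le_trans xz') // ltnW.
right; rewrite l'E r'E addn0 lE -addnS rE -mulSnr.
have modM q q' : q = q' %[mod k n] -> q' * m = q * m %[mod k n * m].
  by move=> qq'; rewrite -!muln_modl qq'.
exact: modM il'.
Qed.

Lemma edge_has_private l : exists s, forall l', edge x l' s <-> l' = l.
Proof.
have [_ x0f xml _] := subx.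
have rm : l %% m < m by rewrite ltn_mod.
have : (x (l %% m) < x (l %% m).+1)%O by rewrite xlt // ltnW.
move/(ordered_continuum_dense contL) => [z /andP[xz zx]].
exists (wind (edge_arc l) z) => l'.
rewrite /edge /= (@coord_wind _ _ _ _ _ _ _ (edge_arc l)) //.
split=> [|->]; last by exists z => //; rewrite /= !ltW.
move=> [z' /andP[xz' zx']].
have r'm : l' %% m < m by rewrite ltn_mod.
move/circle_ptP => /(_ contL) [[l'l z'z]|[_ zf _]|[zl _ _]]; first last.
- by have := le_lt_trans (zl (x (l %% m).+1)) zx; rewrite ltxx.
- by have := lt_le_trans xz (zf (x (l %% m))); rewrite ltxx.
rewrite {z'}z'z in xz' zx'.
have rr' : l %% m < (l' %% m).+1.
  by rewrite -xlt // ?(lt_le_trans xz zx') // ltnW.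
have r'r : l' %% m < (l %% m).+1.
  by rewrite -xlt // ?(le_lt_trans xz' zx) // ltnW.
apply: val_inj => /=.
have /= := congr1 val l'l => l'l_div.
by rewrite (divn_eq l' m) (divn_eq l m) l'l_div; lia.
Qed.

End Edges.

Lemma solenoid_circle_like : circle_like S.
Proof.
move=> C oC covC; have [n /choice[U UP]] := open_cover_level oC covC.
have [[lo loP] [hi hiP]] :=
  (ordered_continuum_first contL, ordered_continuum_last contL).
have nbhsU (i : 'I_(k n)) c z : circle_pt i z = c ->
    nbhs z (circle_pt i @^-1` U c).
  move=> izc; have [oU Uc _] := UP c; apply: open_nbhs_nbhs; split.
    by move/circle_openP : oU.
  by rewrite /= izc.
pose G (a b : L) := forall i : 'I_(k n),
  small C (circle_pt i @` [set z | (a <= z <= b)%O]).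
have locG z : exists a b, itv_interior a b z /\ G a b.
  have /(nbhs_itv_interior contL)[a [b [abz abU]]] :
      nbhs z [set w | forall i : 'I_(k n), U (circle_pt i z) (circle_pt i w)].
    by apply: filter_forall => i; exact: nbhsU.
  exists a, b; split=> // i; have [_ _ [V CV UV]] := UP (circle_pt i z).
  exists V => // s [w abw ws]; apply: UV; rewrite /= -ws; apply: abU.
  by rewrite /= in_itv.
have antiG a b a' b' : (a <= a')%O -> (b' <= b)%O -> G a b -> G a' b'.
  move=> aa' bb' Gab i; have [V CV Vab] := Gab i; exists V => // s [w /andP[aw wb] ws].
  by apply: Vab; exists w => //; rewrite /= (le_trans aa') // (le_trans wb).
(* Around a glued endpoint the two edges are on different arcs.  Nodes [a] and [b]
   are forced so that both edges are in the open set chosen at that endpoint. *)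
have succ_lo i : circle_pt (ordS i) lo = circle_pt i hi :> circle L (k n).
  by apply/circle_ptP => //; constructor 3; split=> //=; rewrite modn_mod.
have [a a_hi aU] : exists2 a, (a < hi)%O & forall z, (a <= z)%O ->
    forall i : 'I_(k n), U (circle_pt i hi) (circle_pt i z).
  have /(nbhs_itv_interior contL)[a [b [[ahi bhi] abU]]] :
      nbhs hi [set w | forall i : 'I_(k n), U (circle_pt i hi) (circle_pt i w)].
    by apply: filter_forall => i; exact: nbhsU.
  exists a; first by case: ahi => // af; exact: first_lt_last.
  move=> z az; apply: abU; rewrite /= in_itv /= az.
  by case: bhi => [bl|/ltW hib]; [exact: bl|exact: le_trans (hiP z) hib].
have [b lo_b bU] : exists2 b, (lo < b)%O & forall z, (z <= b)%O ->
    forall i : 'I_(k n), U (circle_pt i hi) (circle_pt (ordS i) z).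
  have /(nbhs_itv_interior contL)[a' [b [[alo blo] abU]]] : nbhs lo
      [set w | forall i : 'I_(k n), U (circle_pt i hi) (circle_pt (ordS i) w)].
    by apply: filter_forall => i; exact: nbhsU.
  exists b; first by case: blo => // bl; exact: first_lt_last.
  move=> z zb; apply: abU; rewrite /= in_itv /= zb andbT.
  by case: alo => [af|/ltW alo]; [exact: af|exact: le_trans alo (loP z)].
have [m [x [subx fineG ends]]] := fine_subdivision contL [:: a; b] locG antiG.
have [m_gt0 x0f xml xmono] := subx.
have xm : x m = hi by exact: is_last_unique.
have x0 : x 0 = lo by exact: is_first_unique.
have cover_edge := edge_adjacent n subx.
pose Ex := edge x : 'I_(k n * m) -> set S.
exists (k n * m), (edge_star Ex); split.
- by apply: edge_star_open => l; exact: edge_closed.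
- exact: edge_star_cover cover_edge.
- move=> l.
  have star_edge s : edge_star Ex l s -> exists2 l',
      Ex l' s & same_or_next l l'.
    by move=> ls; have [l' El's _] := cover_edge s; exists l' => //; exact: ls.
  have rm : l %% m < m by rewrite ltn_mod.
  have lE := divn_eq l m.
  have [rS|rS] := ltnP (l %% m).+1 m.
  (* Both edges are on the same arc. *)
  + have lSE : l.+1 = l %/ m * m + (l %% m).+1 by rewrite {1}lE addnS.
    have lSdiv : l.+1 %/ m = l %/ m.
      by rewrite lSE divnMDl // (divn_small rS) addn0.
    have lSmod : l.+1 %% m = (l %% m).+1 by rewrite lSE modnMDl (modn_small rS).
    have lSlt : l.+1 < k n * m.
      rewrite ltn_neqAle ltn_ord andbT; apply/eqP => lSN.
      by move: lSmod; rewrite lSN modnMl.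
    have [V CV GV] := fineG _ rS (edge_arc l).
    exists V => // s /star_edge[l' [z /andP[xz zx] zs] ll'].
    apply: GV; exists z => /=; last first.
      rewrite -zs; congr circle_pt; apply: val_inj => /=.
      by case: ll' => [->//|]; rewrite !modn_small // => ->.
    case: ll' => [l'l|].
      rewrite l'l in xz zx; rewrite xz (le_trans zx) //.
      by rewrite ltW // xmono ?inE // ltnW.
    move=> l'l; rewrite !modn_small // in l'l; rewrite l'l lSmod in xz zx.
    by rewrite zx andbT (le_trans _ xz) // ltW // xmono ?inE // ltnW.
  (* The edge [l] is the last of its arc, and the next one the first of the
     following arc. *)
  + have {rS}rE : (l %% m).+1 = m by apply/eqP; rewrite eqn_leq rm.
    have [_ _ [V CV UV]] := UP (circle_pt (edge_arc l) hi).
    exists V => // s /star_edge[l' [z /andP[xz zx] zs] ll'].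
    apply: UV; rewrite /= -zs; case: ll' => [l'l|l'l].
      rewrite l'l in xz *; apply: aU; apply: le_trans xz.
      have [ka kam xka] := ends a (mem_head _ _).
      move: a_hi; rewrite -xka -xm xmono ?inE // => ka_m.
      have : ka <= l %% m by rewrite -ltnS rE.
      rewrite leq_eqVlt => /predU1P[->//|ka_l].
      by rewrite ltW // xmono ?inE // ltnW.
    have l'E : l' = ((l %/ m).+1 %% k n) * m :> nat.
      move: l'l; rewrite modn_small // => ->; rewrite muln_modl.
      by rewrite mulSnr {1}lE -addnS rE.
    have l'div : l' %/ m = (l %/ m).+1 %% k n by rewrite l'E mulnK.
    have l'mod : l' %% m = 0 by rewrite l'E modnMl.
    have -> : edge_arc l' = ordS (edge_arc l) by exact: val_inj.
    apply: bU; apply: le_trans zx _; rewrite l'mod.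
    have [kb kbm xkb] : exists2 i, i <= m & x i = b.
      by apply: ends; rewrite !inE eqxx orbT.
    move: lo_b; rewrite -xkb -x0 xmono ?inE // leq_eqVlt => /predU1P[<-//|kb1].
    by rewrite ltW // xmono ?inE.
- exact: edge_star_circular cover_edge (edge_has_private subx).
Qed.

End CircleLike.

Theorem theorem2p1 (d : Order.disp_t) (L : orderTopologicalType d)
    (p : nat -> nat) :
  ordered_continuum L -> (forall n : nat, 1 < p n) ->
  [/\ continuum (solenoid L p), indecomposable (solenoid L p)
    & circle_like (solenoid L p)].
Proof.
move=> contL p_gt1; split.
- exact: solenoid_continuum.
- exact: solenoid_indecomposable.
- exact: solenoid_circle_like.
Qed.
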